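(* Let $P(z)\in\mathbb{C}[[z]]$ be Hessian nilpotent with $o(P(z))\ge 2$ and let $Q_t(z)$ be its deformed inversion pair. For any non-zero $s\in\mathbb{C}$ set $$U_{t,s}(z)=\exp(sQ_t(z))=\sum_{k=0}^\infty\frac{s^kQ_t^k(z)}{k!}.$$ Then $U_{t,s}(z)$ is the unique formal power series solution (in $z$ and $t$) of the Cauchy problem of the heat equation $$\frac{\partial U_{t,s}}{\partial t}(z)=\frac{1}{2s}\,\Delta U_{t,s}(z),\qquad U_{t=0,s}(z)=\exp(sP(z)).$$
   Context: Here $z=(z_1,\dots,z_n)$, $t$ is a formal parameter commuting with $z$, $\Delta=\sum_{i=1}^n \partial^2/\partial z_i^2$, and $o(\cdot)$ denotes the order with respect to $z$ (lowest degree in $z$ of a monomial occurring). $P$ is Hessian nilpotent if its Hessian matrix $\left(\frac{\partial^2 P}{\partial z_i\partial z_j}\right)$ is nilpotent. For $P\in\mathbb{C}[[z]]$ with $o(P)\ge 2$, the deformed inversion pair of $P$ is the unique $Q_t(z)\in\mathbb{C}[[z,t]]$ with $o(Q_t(z))\ge 2$ such that $z+t\nabla Q_t(z)$ is the formal (compositional, in $z$) inverse of $z-t\nabla P(z)$, where $\nabla$ is the gradient in $z$. *)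

(* Defs.v *)
From HB Require Import structures.
From mathcomp Require Import all_boot all_order all_algebra.
From mathcomp Require Import boolp reals.
From mathcomp Require Import complex mpoly.

Set Implicit Arguments.
Unset Strict Implicit.
Unset Printing Implicit Defensive.

Import GRing.Theory.
Local Open Scope ring_scope.

(* The ring K[[x_0, ..., x_(n-1)]]: a series is its family of coefficients,
   indexed by the multi-indices 'X_{1..n} of the multinomials library. *)
Record fps (K : Type) (n : nat) := FPS { fps_coef :> 'X_{1..n} -> K }.

Lemma fpsP (K : Type) (n : nat) (f g : fps K n) :
  (forall m, f m = g m) <-> f = g.
Proof.
split=> [|-> //]; case: f g => [f] [g] /= fg.
by congr FPS; apply: functional_extensionality_dep.
Qed.

HB.instance Definition _ (K : Type) (n : nat) := gen_eqMixin (fps K n).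
HB.instance Definition _ (K : Type) (n : nat) := gen_choiceMixin (fps K n).

Section Ring.
Variables (K : comNzRingType) (n : nat).
Implicit Types (f g h : fps K n) (m : 'X_{1..n}).

Definition fps_zero : fps K n := FPS (fun _ => 0).
Definition fps_opp f : fps K n := FPS (fun m => - f m).
Definition fps_add f g : fps K n := FPS (fun m => f m + g m).
Definition fps_one : fps K n := FPS (fun m => (m == 0%MM)%:R).

(* The size bounds on k.1 and k.2 only make the index type finite: they follow
   from k.1 + k.2 = m.  This is the formula mcoeffM for polynomials. *)
Definition fps_mul f g : fps K n :=
  FPS (fun m => \sum_(k : 'X_{1..n < (mdeg m).+1, (mdeg m).+1}
                       | m == (k.1 + k.2)%MM) f k.1 * g k.2).
Definition fps_scale (c : K) f : fps K n := FPS (fun m => c * f m).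

Fact fps_addA : associative fps_add.
Proof. by move=> f g h; apply/fpsP=> m /=; rewrite addrA. Qed.
Fact fps_addC : commutative fps_add.
Proof. by move=> f g; apply/fpsP=> m /=; rewrite addrC. Qed.
Fact fps_add0 : left_id fps_zero fps_add.
Proof. by move=> f; apply/fpsP=> m /=; rewrite add0r. Qed.
Fact fps_addN : left_inverse fps_zero fps_opp fps_add.
Proof. by move=> f; apply/fpsP=> m /=; rewrite addNr. Qed.

HB.instance Definition _ :=
  GRing.isZmodule.Build (fps K n) fps_addA fps_addC fps_add0 fps_addN.

(* The polynomial formed by the terms of f of total degree less than d. *)
Definition fps_trunc (d : nat) f : {mpoly K[n]} :=
  \sum_(m : 'X_{1..n < d}) f m *: 'X_[m].

Lemma mcoeff_fps_trunc d f m :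
  (fps_trunc d f)@_m = if (mdeg m < d)%N then f m else 0.
Proof.
rewrite /fps_trunc raddf_sum /=; case: ifP => hm.
  rewrite (bigD1 (BMultinom hm)) //= mcoeffZ mcoeffX eqxx mulr1.
  rewrite big1 ?addr0 // => k; rewrite bmeqP /= => /negbTE kn.
  by rewrite mcoeffZ mcoeffX kn mulr0.
rewrite big1 // => k _; rewrite mcoeffZ mcoeffX.
by case: eqP => [km|]; [rewrite -km bmdeg in hm | rewrite mulr0].
Qed.

Lemma fps_mul_trunc d f g (p q : {mpoly K[n]}) m : (mdeg m < d)%N ->
  (forall k, (mdeg k < d)%N -> p@_k = f k) ->
  (forall k, (mdeg k < d)%N -> q@_k = g k) ->
  fps_mul f g m = (p * q)@_m.
Proof.
move=> hm pf qg; rewrite mcoeffM /=; apply: eq_bigr => k _.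
by rewrite pf ?qg //; apply: (leq_trans (bmdeg _)).
Qed.

Fact fps_mulA : associative fps_mul.
Proof.
move=> f g h; apply/fpsP=> m; set d := (mdeg m).+1.
have tr f' k : (mdeg k < d)%N -> (fps_trunc d f')@_k = f' k.
  by rewrite mcoeff_fps_trunc => ->.
have trM f' g' k : (mdeg k < d)%N ->
    (fps_trunc d f' * fps_trunc d g')@_k = fps_mul f' g' k.
  by move=> hk; apply/esym/(fps_mul_trunc hk); apply: tr.
have hm : (mdeg m < d)%N by [].
rewrite (fps_mul_trunc hm (tr f) (trM g h)).
by rewrite (fps_mul_trunc hm (trM f g) (tr h)) mulrA.
Qed.

Fact fps_mulC : commutative fps_mul.
Proof.
move=> f g; apply/fpsP=> m; set d := (mdeg m).+1.
have tr f' k : (mdeg k < d)%N -> (fps_trunc d f')@_k = f' k.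
  by rewrite mcoeff_fps_trunc => ->.
have hm : (mdeg m < d)%N by [].
rewrite (fps_mul_trunc hm (tr f) (tr g)).
by rewrite (fps_mul_trunc hm (tr g) (tr f)) mulrC.
Qed.

Fact fps_mul1 : left_id fps_one fps_mul.
Proof.
move=> f; apply/fpsP=> m; set d := (mdeg m).+1.
have tr f' k : (mdeg k < d)%N -> (fps_trunc d f')@_k = f' k.
  by rewrite mcoeff_fps_trunc => ->.
have hm : (mdeg m < d)%N by [].
have tr1 k : (mdeg k < d)%N -> (1 : {mpoly K[n]})@_k = fps_one k.
  by rewrite mcoeff1.
by rewrite (fps_mul_trunc hm tr1 (tr f)) mul1r tr.
Qed.

Fact fps_mulDl : left_distributive fps_mul fps_add.
Proof.
move=> f g h; apply/fpsP=> m /=; rewrite -big_split /=.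
by apply: eq_bigr => k _; rewrite mulrDl.
Qed.

Fact fps_one_neq0 : fps_one != 0.
Proof.
apply/eqP => /fpsP /(_ 0%MM) /=; rewrite eqxx => /eqP.
by rewrite oner_eq0.
Qed.

HB.instance Definition _ :=
  GRing.Zmodule_isComNzRing.Build (fps K n)
    fps_mulA fps_mulC fps_mul1 fps_mulDl fps_one_neq0.

Fact fps_scaleA (a b : K) f : fps_scale a (fps_scale b f) = fps_scale (a * b) f.
Proof. by apply/fpsP=> m /=; rewrite mulrA. Qed.
Fact fps_scale1 : left_id 1 fps_scale.
Proof. by move=> f; apply/fpsP=> m /=; rewrite mul1r. Qed.
Fact fps_scaleDr : right_distributive fps_scale +%R.
Proof. by move=> a f g; apply/fpsP=> m /=; rewrite mulrDr. Qed.
Fact fps_scaleDl f : {morph fps_scale^~ f : a b / a + b}.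
Proof. by move=> a b; apply/fpsP=> m /=; rewrite mulrDl. Qed.

HB.instance Definition _ :=
  GRing.Zmodule_isLmodule.Build K (fps K n)
    fps_scaleA fps_scale1 fps_scaleDr fps_scaleDl.

Fact fps_scaleAl (a : K) f g : a *: (f * g) = (a *: f) * g.
Proof.
apply/fpsP=> m /=; rewrite mulr_sumr.
by apply: eq_bigr => k _; rewrite mulrA.
Qed.
HB.instance Definition _ :=
  GRing.Lmodule_isLalgebra.Build K (fps K n) fps_scaleAl.

Fact fps_scaleAr (a : K) f g : a *: (f * g) = f * (a *: g).
Proof. by rewrite mulrC scalerAl mulrC. Qed.
HB.instance Definition _ :=
  GRing.Lalgebra_isAlgebra.Build K (fps K n) fps_scaleAr.

Lemma fpsD f g m : (f + g) m = f m + g m. Proof. by []. Qed.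
Lemma fpsN f m : (- f) m = - f m. Proof. by []. Qed.
Lemma fpsZ (c : K) f m : (c *: f) m = c * f m. Proof. by []. Qed.
Lemma fps0 m : (0 : fps K n) m = 0. Proof. by []. Qed.
Lemma fps1 m : (1 : fps K n) m = (m == 0%MM)%:R. Proof. by []. Qed.
Lemma fpsM f g m :
  (f * g) m = \sum_(k : 'X_{1..n < (mdeg m).+1, (mdeg m).+1}
                     | m == (k.1 + k.2)%MM) f k.1 * g k.2.
Proof. by []. Qed.

Lemma fps_sum (I : Type) (r : seq I) (A : pred I) (F : I -> fps K n) m :
  (\sum_(i <- r | A i) F i) m = \sum_(i <- r | A i) F i m.
Proof.
exact: (big_morph (fun f : fps K n => f m) (fun f g => fpsD f g m) (fps0 m)).
Qed.

Definition fps_var (i : 'I_n) : fps K n := FPS (fun m => (m == U_(i)%MM)%:R).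

Definition fps_deriv (i : 'I_n) f : fps K n :=
  FPS (fun m => (m i).+1%:R * f (m + U_(i))%MM).

(* o(f) >= d; in particular the order of 0 is +oo. *)
Definition fps_order_ge (d : nat) f : Prop :=
  forall m, f m != 0 -> (d <= mdeg m)%N.

Lemma fps_order_ge0 f : fps_order_ge 0 f. Proof. by []. Qed.

Lemma fps_order_geM d e f g :
  fps_order_ge d f -> fps_order_ge e g -> fps_order_ge (d + e) (f * g).
Proof.
move=> df eg m; apply: contraR; rewrite -ltnNge fpsM => hm.
apply/eqP; apply: big1 => k /eqP mk.
have [->|/df h1] := eqVneq (f k.1) 0; first by rewrite mul0r.
have [->|/eg h2] := eqVneq (g k.2) 0; first by rewrite mulr0.
by have := leq_add h1 h2; rewrite -mdegD -mk leqNgt hm.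
Qed.

Lemma fps_order_geX d f k : fps_order_ge d f -> fps_order_ge (d * k) (f ^+ k).
Proof.
move=> df; elim: k => [|k IH]; first by rewrite muln0.
by rewrite exprS mulnS; apply: fps_order_geM.
Qed.

End Ring.

(* The Hessian matrix, over the commutative ring K[[x]]. *)
Definition fps_hessian (K : comNzRingType) (n : nat) (P : fps K n) :
  'M[fps K n]_n := \matrix_(i, j) fps_deriv i (fps_deriv j P).

Definition hessian_nilpotent (K : comNzRingType) (n : nat) (P : fps K n) : Prop :=
  exists k : nat, fps_hessian P ^+ k = 0.

(* Substitution f(g_0, ..., g_(n-1)) = sum_a f_a g^a.  It is meaningful when all
   the g_i have zero constant term: g^a then has no term of total degree less
   than |a|, so only the finitely many a with |a| <= |m| contribute to the
   coefficient of x^m, and the infinite sum is the one below (fps_comp_wideE). *)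
Definition fps_comp (K : comNzRingType) (n p : nat) (f : fps K n)
    (g : 'I_n -> fps K p) : fps K p :=
  FPS (fun m => \sum_(a : 'X_{1..n < (mdeg m).+1})
                  f a * (\prod_(i < n) g i ^+ a i) m).

(* exp(f) = sum_k f^k / k!.  It is meaningful when f has zero constant term: only
   the finitely many k <= |m| then contribute to the coefficient of x^m, and the
   infinite sum is the one below (fps_exp_wideE). *)
Definition fps_exp (K : fieldType) (n : nat) (f : fps K n) : fps K n :=
  FPS (fun m => \sum_(k < (mdeg m).+1) (k`!%:R^-1 *: f ^+ k) m).

Section Truncation.
Variables (n p : nat).

Lemma fps_comp_wideE (K : comNzRingType) (f : fps K n) (g : 'I_n -> fps K p)
    (m : 'X_{1..p}) (d : nat) :
  (forall i, g i 0%MM = 0) -> (mdeg m < d)%N ->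
  fps_comp f g m = \sum_(a : 'X_{1..n < d}) f a * (\prod_(i < n) g i ^+ a i) m.
Proof.
move=> g0 hd.
have g1 i : fps_order_ge 1 (g i).
  move=> k; rewrite lt0n; apply: contraNneq => /eqP.
  by rewrite mdeg_eq0 => /eqP ->; rewrite g0.
have gM (a : 'X_{1..n}) : fps_order_ge (mdeg a) (\prod_(i < n) g i ^+ a i).
  rewrite mdegE; elim/big_ind2: _ => [||i _]; first exact: fps_order_ge0.
    by move=> *; apply: fps_order_geM.
  by have := @fps_order_geX _ _ _ _ (a i) (g1 i); rewrite mul1n.
set F := fun a : 'X_{1..n} => f a * (\prod_(i < n) g i ^+ a i) m.
rewrite -[LHS]/(\sum_(a : 'X_{1..n < (mdeg m).+1}) F a).
rewrite -[RHS]/(\sum_(a : 'X_{1..n < d}) F a).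
have Fz (a : 'X_{1..n}) : ~~ (mdeg a < (mdeg m).+1)%N -> F a = 0.
  move=> ha; rewrite /F; have [->|/gM h] := eqVneq ((\prod_(i < n) g i ^+ a i) m) 0.
    by rewrite mulr0.
  by rewrite ltnS h in ha.
rewrite [RHS](bigID (fun a : 'X_{1..n < d} => (mdeg a < (mdeg m).+1)%N)) /=.
rewrite [X in _ = _ + X]big1 ?addr0; last by move=> a; apply: Fz.
pose w (a : 'X_{1..n < (mdeg m).+1}) : 'X_{1..n < d} :=
  BMultinom (leq_trans (bmdeg a) hd).
pose v (a : 'X_{1..n < d}) : 'X_{1..n < (mdeg m).+1} := insubd bm0 (val a).
rewrite (reindex_onto w v) /=; last first.
  by move=> a ha; apply/val_inj; rewrite /= /v val_insubd ha.
apply: eq_bigl => a; rewrite bmdeg /=; apply/esym/eqP/val_inj.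
by rewrite /v val_insubd /= bmdeg.
Qed.

Lemma fps_exp_wideE (K : fieldType) (f : fps K p) (m : 'X_{1..p}) (d : nat) :
  f 0%MM = 0 -> (mdeg m < d)%N ->
  fps_exp f m = \sum_(k < d) (k`!%:R^-1 *: f ^+ k) m.
Proof.
move=> f0 hd; have f1 : fps_order_ge 1 f.
  move=> k; rewrite lt0n; apply: contraNneq => /eqP.
  by rewrite mdeg_eq0 => /eqP ->; rewrite f0.
set F := fun k : nat => (k`!%:R^-1 *: f ^+ k) m.
rewrite -[LHS]/(\sum_(k < (mdeg m).+1) F k) -[RHS]/(\sum_(k < d) F k).
rewrite (big_ord_widen d F hd) [RHS](bigID (fun k : 'I_d => (k < (mdeg m).+1)%N)) /=.
rewrite [X in _ = _ + X]big1 ?addr0 // => k hk; rewrite /F fpsZ.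
have [->|h] := eqVneq ((f ^+ k) m) 0; first by rewrite mulr0.
by have := fps_order_geX f1 h; rewrite mul1n => hm; rewrite ltnS hm in hk.
Qed.

End Truncation.

(* K[[z, t]] is fps K n.+1: z_i is the variable of index zidx i, and t is the
   last variable, of index ord_max. *)
Section TimeDependent.
Variables (K : comNzRingType) (n : nat).
Implicit Types (f P : fps K n) (F Q : fps K n.+1).

Definition zidx (i : 'I_n) : 'I_n.+1 := widen_ord (leqnSn n) i.
Definition zvar (i : 'I_n) : fps K n.+1 := fps_var K (zidx i).
Definition tvar : fps K n.+1 := fps_var K ord_max.

(* The inclusion of K[[z]] in K[[z, t]]. *)
Definition fps_widen f : fps K n.+1 :=
  FPS (fun m => if m ord_max == 0%N
                then f [multinom m (zidx i) | i < n]%MM else 0).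

(* F(z, 0); mnmwiden appends the exponent 0 of t. *)
Definition fps_at_t0 F : fps K n := FPS (fun m => F (mnmwiden m)).

(* Order with respect to z only. *)
Definition zorder_ge (d : nat) F : Prop :=
  forall m : 'X_{1..n.+1}, F m != 0 -> (d <= \sum_(i < n) m (zidx i))%N.

Definition zlaplacian F : fps K n.+1 :=
  \sum_(i < n) fps_deriv (zidx i) (fps_deriv (zidx i) F).

(* F(G(z, t), t) *)
Definition zsubst F (G : 'I_n -> fps K n.+1) : fps K n.+1 :=
  fps_comp F (fun i => if unlift ord_max i is Some j then G j else tvar).

Definition zinverse (F G : 'I_n -> fps K n.+1) : Prop :=
  (forall i, zsubst (F i) G = zvar i) /\ (forall i, zsubst (G i) F = zvar i).

(* Q_t is determined by these conditions: they fix its z-gradient, and the order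
   condition excludes terms free of z. *)
Definition deformed_inversion_pair P Q : Prop :=
  zorder_ge 2 Q /\
  zinverse (fun i => zvar i - tvar * fps_widen (fps_deriv i P))
           (fun i => zvar i + tvar * fps_deriv (zidx i) Q).

End TimeDependent.

Definition heat_cauchy_solution (K : fieldType) (n : nat) (s : K) (P : fps K n)
    (U : fps K n.+1) : Prop :=
  fps_deriv ord_max U = (1 / (2 * s)) *: zlaplacian U /\
  fps_at_t0 U = fps_exp (s *: P).

(* Main.v *)
(* Write q = grad Q, J = Hess Q and A = (Hess P)(z + t q).  The inversion
   identity, after cancelling t, reads q = (grad P)(z + t q).  Differentiating
   it in z gives J = (1 + t J) A, so 1 + t J is the inverse of 1 - t A, commutes
   with A, and J is nilpotent together with A: Delta Q = tr J = 0.
   Differentiating it in t gives dq/dt = q J = grad (|q|^2 / 2), whence the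
   Hamilton-Jacobi equation dQ/dt = |q|^2 / 2, as both sides have no term free
   of z.  For U = exp(s Q) one has Delta U = (s Delta Q + s^2 |q|^2) U, which is
   then 2 s dU/dt.  Uniqueness: the heat equation determines the coefficient of
   t^(k+1) from that of t^k. *)
From HB Require Import structures.
Require Import Defs.
From mathcomp Require Import all_boot all_order all_algebra.
From mathcomp Require Import boolp reals complex mpoly.

Set Implicit Arguments.
Unset Strict Implicit.
Unset Printing Implicit Defensive.

Import Order.TTheory GRing.Theory Num.Theory.
Local Open Scope ring_scope.

(** * Linear maps on power series, continuous for the order filtration *)

Section Continuity.
Variable K : comNzRingType.

Definition fps_mono n (a : 'X_{1..n}) : fps K n := FPS (fun m => (m == a)%:R).

Lemma fps_order_geP n d (f : fps K n) :
  fps_order_ge d f <-> forall m, (mdeg m < d)%N -> f m = 0.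
Proof.
split=> fd m; first by rewrite ltnNge; apply: contraNeq; apply: fd.
by apply: contraNT; rewrite -ltnNge => /fd ->.
Qed.

Lemma fps_order_geD n d (f g : fps K n) :
  fps_order_ge d f -> fps_order_ge d g -> fps_order_ge d (f + g).
Proof.
move=> /fps_order_geP fd /fps_order_geP gd; apply/fps_order_geP => m md.
by rewrite fpsD fd ?gd ?addr0.
Qed.

Lemma fps_order_ge_sum n d (I : Type) (r : seq I) (A : pred I) (F : I -> fps K n) :
  (forall i, A i -> fps_order_ge d (F i)) ->
  fps_order_ge d (\sum_(i <- r | A i) F i).
Proof.
move=> Fd; elim/big_ind: _ => //; last exact: fps_order_geD.
by move=> m; rewrite fps0 eqxx.
Qed.

Lemma fps_order_geMl n d (f g : fps K n) :
  fps_order_ge d g -> fps_order_ge d (f * g).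
Proof. by rewrite -{2}[d]add0n; apply: fps_order_geM. Qed.

Lemma fps_order_geMr n d (f g : fps K n) :
  fps_order_ge d f -> fps_order_ge d (f * g).
Proof. by rewrite mulrC; apply: fps_order_geMl. Qed.

Lemma fps_order_ge1 n (f : fps K n) : f 0%MM = 0 -> fps_order_ge 1 f.
Proof.
move=> f0; apply/fps_order_geP => m.
by rewrite ltnS leqn0 mdeg_eq0 => /eqP ->.
Qed.

Lemma fps_order_ge_mono_sum n d (f : fps K n) :
  fps_order_ge d (f - \sum_(a : 'X_{1..n < d}) f a *: fps_mono a).
Proof.
apply/fps_order_geP => m md; rewrite fpsD fpsN fps_sum.
rewrite (bigD1 (BMultinom md)) //= big1 => [|a]; first by rewrite eqxx mulr1 addr0 subrr.
by rewrite -val_eqE /= eq_sym => /negbTE ->; rewrite mulr0.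
Qed.

(** Continuity at 0 for the topology in which the series of order at least d form a basis of
    neighbourhoods of 0. *)
Definition fps_continuous n p (L : fps K n -> fps K p) :=
  forall d, exists e, forall f, fps_order_ge e f -> fps_order_ge d (L f).

Lemma fps_linear_mono_sum n p (L : fps K n -> fps K p) d f h :
  linear L -> L (f + \sum_(a : 'X_{1..n < d}) h a *: fps_mono a) =
  L f + \sum_(a : 'X_{1..n < d}) h a *: L (fps_mono a).
Proof.
move=> linL; have LD u v : L (u + v) = L u + L v.
  by have := linL 1 u v; rewrite !scale1r.
have L0 : L 0 = 0 by apply: (addIr (L 0)); rewrite -LD !add0r.
have LZ c u : L (c *: u) = c *: L u by rewrite -[X in L X]addr0 linL L0 addr0.
by rewrite LD (big_morph L LD L0); congr (_ + _); apply: eq_bigr.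
Qed.

(** Up to terms of high order a series is a finite combination of monomials, and continuity keeps
    the image of the remainder away from a given coefficient. Identities that are linear in a series
    are reduced to monomials in this way. *)
Lemma fps_linear_ext n p (L1 L2 : fps K n -> fps K p) :
  linear L1 -> linear L2 -> fps_continuous L1 -> fps_continuous L2 ->
  (forall a, L1 (fps_mono a) = L2 (fps_mono a)) -> L1 =1 L2.
Proof.
move=> lin1 lin2 cont1 cont2 mono f.
apply/fpsP => m; have [e1 le1] := cont1 (mdeg m).+1.
have [e2 le2] := cont2 (mdeg m).+1.
set d := maxn e1 e2.
have lew e (h : fps K n) : (e <= d)%N -> fps_order_ge d h -> fps_order_ge e h.
  by move=> ed hd k /hd; apply: leq_trans.
have := @fps_order_ge_mono_sum _ d f; set h := \sum_a _ => fh.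
rewrite -[f](subrK h) !fps_linear_mono_sum // !fpsD.
rewrite (iffLR (fps_order_geP _ _) (le1 _ (lew _ _ _ fh))) ?leq_maxl //.
rewrite (iffLR (fps_order_geP _ _) (le2 _ (lew _ _ _ fh))) ?leq_maxr //.
by rewrite !fps_sum; congr (_ + _); apply: eq_bigr => a _; rewrite !fpsZ mono.
Qed.

End Continuity.

(** * Partial derivatives *)

Section Derivation.
Variables (K : comNzRingType) (n : nat).
Implicit Types (f g : fps K n) (a b : 'X_{1..n}) (i : 'I_n).

Fact fps_deriv_is_linear i : linear (@fps_deriv K n i).
Proof. by move=> c f g; apply/fpsP=> m /=; rewrite mulrDr mulrCA. Qed.

HB.instance Definition _ i :=
  GRing.isLinear.Build K (fps K n) (fps K n) _ (@fps_deriv K n i)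
    (fps_deriv_is_linear i).

Lemma fps_derivM i f g :
  fps_deriv i (f * g) = fps_deriv i f * g + f * fps_deriv i g.
Proof.
(* The coefficient of a derivative at [m] involves degree [mdeg m + 1], so truncation below
   [mdeg m + 2] reduces the claim to the Leibniz rule for polynomials. *)
apply/fpsP=> m; set d := (mdeg m).+2.
have tr (h : fps K n) k : (mdeg k < d)%N -> (fps_trunc d h)@_k = h k.
  by rewrite mcoeff_fps_trunc => ->.
have dtr (h : fps K n) k : (mdeg k < d.-1)%N -> ((fps_trunc d h)^`M(i))@_k = fps_deriv i h k.
  move=> kd; have kd' : (mdeg (k + U_(i)) < d)%N by rewrite mdegD mdeg1 addn1.
  by rewrite mcoeff_deriv tr // -mulr_natl.
have tr1 (h : fps K n) k : (mdeg k < d.-1)%N -> (fps_trunc d h)@_k = h k.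
  by move=> kd; apply: tr; apply: ltnW.
have md : (mdeg m < d.-1)%N by [].
have md' : (mdeg (m + U_(i)) < d)%N by rewrite mdegD mdeg1 addn1.
rewrite -[LHS]/(_ * fps_mul f g _) (fps_mul_trunc md' (tr f) (tr g)).
rewrite mulr_natl -mcoeff_deriv mderivM mcoeffD fpsD.
congr (_ + _); symmetry; first exact: fps_mul_trunc md (dtr f) (tr1 g).
exact: fps_mul_trunc md (tr1 f) (dtr g).
Qed.

Lemma fps_deriv1 i : fps_deriv i (1 : fps K n) = 0.
Proof.
have := fps_derivM i 1 1; rewrite !mulr1 mul1r => h.
by apply: (addrI (fps_deriv i 1)); rewrite -h addr0.
Qed.

Lemma fps_derivX i f k :
  fps_deriv i (f ^+ k.+1) = k.+1%:R *: (f ^+ k * fps_deriv i f).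
Proof.
elim: k => [|k IH]; first by rewrite scale1r mul1r.
by rewrite exprS fps_derivM IH -scalerAr mulrA -exprS mulrC !scaler_nat -mulrS.
Qed.

Lemma fps_deriv_comm i j f : fps_deriv i (fps_deriv j f) = fps_deriv j (fps_deriv i f).
Proof.
apply/fpsP=> m /=; rewrite !mnmDE !mnm1E -!addmA [(U_(j) + _)%MM]addmC.
have [->//|_] := eqVneq i j; by rewrite !addn0 mulrCA.
Qed.

Lemma fps_deriv_order_ge d i f : fps_order_ge d.+1 f -> fps_order_ge d (fps_deriv i f).
Proof.
move=> /fps_order_geP fd; apply/fps_order_geP => m md /=.
by rewrite fd ?mulr0 // mdegD mdeg1 addn1.
Qed.

Lemma fps_deriv_var i j : fps_deriv i (fps_var K j) = (i == j)%:R.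
Proof.
apply/fpsP=> m /=; have [<-|ij] := eqVneq i j; last first.
  rewrite (_ : (_ == _) = false) ?mulr0 //; apply/eqP => /mnmP /(_ i).
  by rewrite mnmDE !mnm1E eqxx (eq_sym j) (negbTE ij) addn1.
rewrite mulr1n fps1 -{2}[U_(i)%MM]add0m eqm_add2r; have [->|_] := eqVneq; last by rewrite mulr0.
by rewrite mnm0E mulr1.
Qed.

End Derivation.

(** * Monomials as products of variables *)

Section Monomials.
Variables (K : comNzRingType) (n : nat).
Implicit Types (f g : fps K n) (a b : 'X_{1..n}) (i : 'I_n).
Local Notation mono := (@fps_mono K n).

Lemma fps_monoM a b : mono (a + b)%MM = mono a * mono b.
Proof.
apply/fpsP=> m; rewrite fpsM /=.
have [->|mab] := eqVneq m (a + b)%MM.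
  have ha : (mdeg a < (mdeg (a + b)).+1)%N by rewrite mdegD ltnS leq_addr.
  have hb : (mdeg b < (mdeg (a + b)).+1)%N by rewrite mdegD ltnS leq_addl.
  rewrite (bigD1 (BMultinom ha, BMultinom hb)) //= !eqxx mulr1 big1 ?addr0 // => k /andP[_ kn].
  have [h1|] := eqVneq (val k.1) a; last by rewrite mul0r.
  have [h2|] := eqVneq (val k.2) b; last by rewrite mulr0.
  case/eqP: kn; case: k h1 h2 => k1 k2 /= h1 h2; congr pair; exact: val_inj.
rewrite big1 // => k /eqP mk.
have [h1|] := eqVneq (val k.1) a; last by rewrite mul0r.
have [h2|] := eqVneq (val k.2) b; last by rewrite mulr0.
by case/eqP: mab; rewrite mk h1 h2.
Qed.

Lemma fps_mono0 : mono 0%MM = 1.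
Proof. exact/fpsP. Qed.

Lemma fps_monoE a : mono a = \prod_(i < n) fps_var K i ^+ a i.
Proof.
rewrite {1}(multinomUE_id a) (big_morph mono fps_monoM fps_mono0).
apply: eq_bigr => i _; elim: (a i) => [|k IH]; first by rewrite mulm0n fps_mono0.
by rewrite mulmS fps_monoM IH exprS.
Qed.

End Monomials.

(** * Substitution: multiplicativity and chain rule *)

Section Composition.
Variables (K : comNzRingType) (n p : nat) (g : 'I_n -> fps K p).
Implicit Types (f h : fps K n).

Fact fps_comp_is_linear : linear (fun f : fps K n => fps_comp f g).
Proof.
move=> c f h; apply/fpsP=> m /=; rewrite mulr_sumr -big_split /=.
by apply: eq_bigr => a _; rewrite mulrDl mulrA.
Qed.

Lemma fps_compD f h : fps_comp (f + h) g = fps_comp f g + fps_comp h g.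
Proof. by have := fps_comp_is_linear 1 f h; rewrite !scale1r. Qed.

Lemma fps_compB f h : fps_comp (f - h) g = fps_comp f g - fps_comp h g.
Proof.
have := fps_comp_is_linear (-1) h f; rewrite !scaleN1r => e.
by rewrite addrC e addrC.
Qed.

Lemma fps_comp0 : fps_comp (0 : fps K n) g = 0.
Proof. by rewrite -(subrr 0) fps_compB subrr. Qed.

Hypothesis g0 : forall i, g i 0%MM = 0.

Lemma fps_comp_order_ge d f : fps_order_ge d f -> fps_order_ge d (fps_comp f g).
Proof.
move=> /fps_order_geP fd; apply/fps_order_geP => m md.
rewrite (fps_comp_wideE f g0 md) big1 // => a _.
by rewrite fd ?mul0r // bmdeg.
Qed.

Lemma fps_comp_continuous : fps_continuous (fun f => fps_comp f g).
Proof. by move=> d; exists d => f; apply: fps_comp_order_ge. Qed.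

Lemma fps_comp_mono a : fps_comp (fps_mono K a) g = \prod_(i < n) g i ^+ a i.
Proof.
(* The bound must exceed [mdeg m] for the finite sum to be valid, and [mdeg a] for the term of index
   [a] to occur in it. *)
apply/fpsP=> m; pose d := maxn (mdeg m).+1 (mdeg a).+1.
have ad : (mdeg a < d)%N by rewrite leq_maxr.
rewrite (@fps_comp_wideE _ _ _ _ _ _ d) ?leq_maxl //.
rewrite (bigD1 (BMultinom ad)) //= [X in _ + X]big1 => [|b]; first by rewrite eqxx mul1r addr0.
by rewrite -val_eqE /= => /negbTE ->; rewrite mul0r.
Qed.

Lemma fps_comp1 : fps_comp 1 g = 1.
Proof.
by rewrite -fps_mono0 fps_comp_mono big1 // => i _; rewrite mnm0E.
Qed.

Lemma fps_comp_var i : fps_comp (fps_var K i) g = g i.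
Proof.
rewrite -[fps_var K i]/(fps_mono K _) fps_comp_mono (bigD1 i) //= mnm1E eqxx expr1.
by rewrite big1 ?mulr1 // => j /negbTE ji; rewrite mnm1E eq_sym ji.
Qed.

(** Both sides are linear and continuous in each factor, so two monomials suffice. *)
Lemma fps_compM f h : fps_comp (f * h) g = fps_comp f g * fps_comp h g.
Proof.
pose lin := fps_comp_is_linear.
move: f; apply: fps_linear_ext.
- by move=> c u v; rewrite mulrDl -scalerAl lin.
- by move=> c u v; rewrite lin mulrDl scalerAl.
- by move=> d; exists d => f fd; apply/fps_comp_order_ge/fps_order_geMr.
- by move=> d; exists d => f fd; apply/fps_order_geMr/fps_comp_order_ge.
move=> a; move: h; apply: fps_linear_ext.
- by move=> c u v; rewrite mulrDr -scalerAr lin.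
- by move=> c u v; rewrite lin mulrDr scalerAr.
- by move=> d; exists d => f fd; apply/fps_comp_order_ge/fps_order_geMl.
- by move=> d; exists d => f fd; apply/fps_order_geMl/fps_comp_order_ge.
move=> b; rewrite -fps_monoM !fps_comp_mono -big_split /=.
by apply: eq_bigr => i _; rewrite mnmDE exprD.
Qed.

(** By linearity and continuity [f] may be a monomial, that is, a product of variables; the rule
    holds for 1 and for variables, and the Leibniz rule carries it over to products. *)
Lemma fps_comp_chain j f :
  fps_deriv j (fps_comp f g) =
  \sum_(i < n) fps_comp (fps_deriv i f) g * fps_deriv j (g i).
Proof.
pose lin := fps_comp_is_linear.
pose chain f := fps_deriv j (fps_comp f g) =
  \sum_(i < n) fps_comp (fps_deriv i f) g * fps_deriv j (g i).
have chain1 : chain 1.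
  rewrite /chain fps_comp1 fps_deriv1 big1 // => i _.
  by rewrite fps_deriv1 fps_comp0 mul0r.
have chainM u v : chain u -> chain v -> chain (u * v).
  rewrite /chain => hu hv; rewrite fps_compM fps_derivM hu hv mulr_suml mulr_sumr.
  rewrite -big_split /=; apply: eq_bigr => i _.
  by rewrite fps_derivM fps_compD !fps_compM mulrDl mulrAC mulrA.
have chain_var i : chain (fps_var K i).
  rewrite /chain fps_comp_var (bigD1 i) //= fps_deriv_var eqxx fps_comp1 mul1r.
  rewrite big1 ?addr0 // => k /negbTE ki; rewrite fps_deriv_var ki.
  by rewrite fps_comp0 mul0r.
move: f; apply: fps_linear_ext.
- by move=> c u v; rewrite lin linearP.
- move=> c u v; rewrite scaler_sumr -big_split; apply: eq_bigr => i _ /=.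
  by rewrite linearP lin mulrDl scalerAl.
- move=> d; exists d.+1 => f fd.
  exact/fps_deriv_order_ge/fps_comp_order_ge.
- move=> d; exists d.+1 => f fd; apply: fps_order_ge_sum => i _.
  exact/fps_order_geMr/fps_comp_order_ge/fps_deriv_order_ge.
move=> a; rewrite -/(chain _) fps_monoE.
elim/big_ind: _ => // i _; elim: (a i) => // k IH; rewrite exprS.
exact: chainM.
Qed.

End Composition.

(** A continuous algebra morphism passes through the infinite sum that defines a substitution. It
    serves to set t = 0 inside the inversion identity. *)
Lemma fps_comp_map (K : comNzRingType) n p q (g : 'I_n -> fps K p)
    (phi : fps K p -> fps K q) f :
  linear phi -> monoid_morphism phi -> fps_continuous phi ->
  (forall i, g i 0%MM = 0) -> (forall i, phi (g i) 0%MM = 0) ->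
  phi (fps_comp f g) = fps_comp f (phi \o g).
Proof.
move=> phiL [phi1 phiM] phiC g0 pg0; move: f; apply: fps_linear_ext.
- by move=> c u v; rewrite fps_comp_is_linear phiL.
- exact: fps_comp_is_linear.
- move=> d; have [e le] := phiC d; exists e => f fe.
  exact/le/fps_comp_order_ge.
- exact: fps_comp_continuous.
move=> a; rewrite !fps_comp_mono // (big_morph phi phiM phi1).
apply: eq_bigr => i _ /=; elim: (a i) => // k IH.
by rewrite !exprS phiM IH.
Qed.

Lemma fps_comp_id (K : comNzRingType) n (f : fps K n) : fps_comp f (fps_var K (n:=n)) = f.
Proof.
have v0 i : fps_var K i 0%MM = 0 :> K.
  by rewrite /= eq_sym mnm1_eq0.
move: f; apply: fps_linear_ext.
- exact: fps_comp_is_linear.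
- by [].
- exact: fps_comp_continuous.
- by move=> d; exists d.
by move=> a; rewrite fps_comp_mono // -fps_monoE.
Qed.

(** * Power series over an integral domain form an integral domain *)

Section IntegralDomain.
Variables (K : idomainType) (n : nat).
Implicit Types (f g h : fps K n).

Lemma fps_lead_coef f : f != 0 ->
  exists2 m, f m != 0 & forall k, f k != 0 -> (m <= k)%O.
Proof.
move=> f_neq0; have [m0 fm0] : exists m, f m != 0.
  apply: contrapT => nex; case/eqP: f_neq0; apply/fpsP => m.
  by apply/eqP; apply: contrapT => /negP fm; apply: nex; exists m.
elim/(ltmwf (n := n)): m0 fm0 => m IH fm.
have [[k km fk]|nex] := pselect (exists2 k, (k < m)%O & f k != 0).
  exact: IH km fk.
exists m => // k fk; rewrite leNgt; apply/negP => km.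
by apply: nex; exists k.
Qed.

(* The product of the coefficients at the least monomials of f and g, for a
   monomial order, is the coefficient of f * g at the product monomial. *)
Lemma fps_mulf_eq0 f g : f * g = 0 -> (f == 0) || (g == 0).
Proof.
move=> fg; apply/negPn; rewrite negb_or; apply/negP => /andP[].
move=> /fps_lead_coef[a fa amin] /fps_lead_coef[b gb bmin].
have := congr1 (fun h : fps K n => h (a + b)%MM) fg; rewrite fps0 fpsM.
have ha : (mdeg a < (mdeg (a + b)).+1)%N by rewrite mdegD ltnS leq_addr.
have hb : (mdeg b < (mdeg (a + b)).+1)%N by rewrite mdegD ltnS leq_addl.
rewrite (bigD1 (BMultinom ha, BMultinom hb)) //= big1.
  by move/eqP; rewrite addr0 mulf_eq0 (negbTE fa) (negbTE gb).
move=> [k l] /= /andP[/eqP kl kln]; apply/eqP; rewrite mulf_eq0.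
(* Minimality gives [a <= k] and [b <= l]; were the first strict, [k + l] would exceed [a + b]. *)
apply: contraNT kln; rewrite negb_or => /andP[/amin ak /bmin bl].
have ka : val k = a.
  apply/eqP; apply: contraT => nka.
  have ak' : (a < val k)%O by rewrite lt_neqAle eq_sym nka.
  by have := ltmc_le_add ak' bl; rewrite -kl ltxx.
have lb : val l = b by move: kl; rewrite ka => /addmI.
by apply/eqP; congr pair; apply: val_inj.
Qed.

(** Invertibility and inverses are taken classically. They complete the integral domain structure,
    which allows cancelling t and applying [mxtrace_nilpotent] to Hessians. *)
Definition fps_unit : pred (fps K n) := fun f => `[< exists g, g * f = 1 >].
Definition fps_inv f : fps K n :=
  if pselect (exists g, g * f = 1) is left h then projT1 (cid h) else f.

Fact fps_mulVf : {in fps_unit, left_inverse 1 fps_inv *%R}.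
Proof.
move=> f /asboolP fu; rewrite /fps_inv.
by case: pselect => // h; case: (cid h).
Qed.

Fact fps_unitPl f g : g * f = 1 -> fps_unit f.
Proof. by move=> gf; apply/asboolP; exists g. Qed.

Fact fps_invf_out : {in [predC fps_unit], fps_inv =1 id}.
Proof.
move=> f /negP fu; rewrite /fps_inv; case: pselect => // h.
by case: fu; apply/asboolP.
Qed.

HB.instance Definition _ :=
  GRing.ComNzRing_hasMulInverse.Build (fps K n) fps_mulVf fps_unitPl fps_invf_out.
HB.instance Definition _ :=
  GRing.ComUnitRing_isIntegral.Build (fps K n) fps_mulf_eq0.

End IntegralDomain.

(** * Trace of a nilpotent matrix *)

Lemma map_mx_exp (R S : pzRingType) (phi : {rmorphism R -> S}) n (A : 'M[R]_n) k :
  map_mx phi (A ^+ k) = map_mx phi A ^+ k.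
Proof.
elim: k => [|k IH]; first by rewrite !expr0 map_mx1.
by rewrite !exprS -IH [LHS]map_mxM.
Qed.

(* The characteristic polynomial divides a power of 'X, hence is one. *)
Lemma mxtrace_nilpotent (D : idomainType) n (A : 'M[D]_n) k : A ^+ k = 0 -> \tr A = 0.
Proof.
have [n0|n_gt0] := posnP n.
  by move=> _; apply: big1 => i; move: (ltn_ord i); rewrite {2}n0.
move=> Ak; apply/eqP; rewrite -oppr_eq0 -char_poly_trace //.
have : char_poly A %| 'X ^+ k ^+ n.
  have comm : GRing.comm ('X%:M : 'M[{poly D}]_n) (map_mx polyC A).
    exact: comm_scalar_mx.
  have Xk j : ('X%:M : 'M[{poly D}]_n) ^+ j = ('X ^+ j)%:M.
    elim: j => [|j IH]; first by rewrite !expr0.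
    by rewrite !exprS IH [RHS]scalar_mxM.
  (* ['X - A] divides ['X ^+ k - A ^+ k], which is the scalar matrix ['X ^+ k]; determinants turn
     this into divisibility of polynomials. *)
  have := subrXX_comm k comm; rewrite -map_mx_exp Ak map_mx0 subr0 Xk.
  move/(congr1 determinant); rewrite det_scalar => ->.
  by rewrite det_mulmx dvdp_mulIl.
rewrite -exprM -['X]subr0 -polyC0 => /dvdp_exp_XsubCP[l _]; rewrite polyC0 subr0.
rewrite eqp_monic ?char_poly_monic ?monicXn // => /eqP cA.
(* The degree identifies the characteristic polynomial as ['X ^+ n]; its coefficient of index n - 1
   is 0, and it is minus the trace. *)
have := size_char_poly A; rewrite cA size_polyXn => -[->].
by rewrite coefXn; case: n n_gt0 {A Ak cA} => //= n _; rewrite ltn_eqF.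
Qed.

(** * Derivatives and the exponential in characteristic zero *)

Section CharacteristicZero.
Variables (K : numFieldType) (n : nat).
Implicit Types (f g : fps K n) (m : 'X_{1..n}).

Lemma fps_deriv_eq0 i f m : fps_deriv i f = 0 -> m i != 0%N -> f m = 0.
Proof.
move=> df mi; have um : (U_(i) <= m)%MM by rewrite lep1mP.
have := congr1 (fun h : fps K n => h (m - U_(i))%MM) df.
by rewrite /= submK // => /eqP; rewrite mulf_eq0 pnatr_eq0 /= => /eqP.
Qed.

(** The derivative of the partial sum [E d.+1] is [E d * fps_deriv i f], and the remainders have too
    high an order to reach the coefficient at [m]. The extra term on the left makes up for the order
    lost by differentiating. *)
Lemma fps_exp_deriv i f : f 0%MM = 0 -> fps_deriv i (fps_exp f) = fps_exp f * fps_deriv i f.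
Proof.
move=> f0; apply/fpsP => m.
pose E d : fps K n := \sum_(k < d) k`!%:R^-1 *: f ^+ k.
have Ed d : fps_order_ge d (fps_exp f - E d).
  apply/fps_order_geP => k kd.
  by rewrite fpsD fpsN (fps_exp_wideE f0 kd) fps_sum subrr.
set d := (mdeg m).+1.
have -> : fps_deriv i (fps_exp f) m = fps_deriv i (E d.+1) m.
  apply/eqP; rewrite -subr_eq0 -fpsN -fpsD -raddfB; apply/eqP.
  by move/fps_order_geP: (@fps_deriv_order_ge _ _ _ i _ (Ed d.+1)) => ->.
have -> : (fps_exp f * fps_deriv i f) m = (E d * fps_deriv i f) m.
  apply/eqP; rewrite -subr_eq0 -fpsN -fpsD -mulrBl; apply/eqP.
  by move/fps_order_geP: (@fps_order_geMr _ _ _ _ (fps_deriv i f) (Ed d)) => ->.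
congr (fps_coef _ m); rewrite /E raddf_sum big_ord_recl /= expr0 linearZ /= fps_deriv1.
rewrite scaler0 add0r mulr_suml; apply: eq_bigr => k _.
rewrite linearZ /= fps_derivX scalerA -scalerAl; congr (_ *: _).
by rewrite /bump leq0n add1n factS natrM invfM mulrAC mulVf ?mul1r // pnatr_eq0.
Qed.

End CharacteristicZero.

(** * Passing between K[[z]] and K[[z, t]] *)

Section Time.
Variables (K : comNzRingType) (n : nat).
Implicit Types (f P : fps K n) (F Q : fps K n.+1) (G : 'I_n -> fps K n.+1).

Lemma zidxE (i : 'I_n) : zidx i = lift ord_max i.
Proof. by apply/val_inj; rewrite /= /bump leqNgt ltn_ord. Qed.

Lemma zidx_neq_max (i : 'I_n) : (zidx i == ord_max) = false.
Proof. by rewrite zidxE eq_sym (negbTE (neq_lift _ _)). Qed.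

Lemma mdeg_zt (m : 'X_{1..n.+1}) : mdeg m = (\sum_(i < n) m (zidx i) + m ord_max)%N.
Proof. by rewrite mdegE big_ord_recr. Qed.

Definition mnmz (m : 'X_{1..n.+1}) : 'X_{1..n} := [multinom m (zidx i) | i < n]%MM.

Lemma mnmwidenK (m : 'X_{1..n.+1}) : m ord_max = 0%N -> mnmwiden (mnmz m) = m.
Proof.
move=> m0; apply/mnmP => i; case: (unliftP ord_max i) => [j ->|->].
  by rewrite -zidxE mnmwiden_widen mnmE.
by rewrite mnmwiden_ordmax.
Qed.

Lemma mnmzK (m : 'X_{1..n}) : mnmz (mnmwiden m) = m.
Proof. by apply/mnmP => i; rewrite mnmE mnmwiden_widen. Qed.

Lemma mdeg_mnmwiden (m : 'X_{1..n}) : mdeg (mnmwiden m) = mdeg m.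
Proof.
rewrite mdeg_zt mnmwiden_ordmax addn0 mdegE.
by apply: eq_bigr => i _; rewrite mnmwiden_widen.
Qed.

Lemma mdeg_mnmz (m : 'X_{1..n.+1}) : (mdeg (mnmz m) <= mdeg m)%N.
Proof.
rewrite mdeg_zt mdegE.
by under eq_bigr do rewrite mnmE; rewrite leq_addr.
Qed.

Lemma fps_widen_mono (a : 'X_{1..n}) : fps_widen (fps_mono K a) = fps_mono K (mnmwiden a).
Proof.
apply/fpsP => m /=; rewrite -/(mnmz m); case: eqP => [m0|mN0].
  congr (nat_of_bool _)%:R; apply/eqP/eqP => [<-|->]; last exact: mnmzK.
  by rewrite mnmwidenK.
by case: eqP => // ma; case: mN0; rewrite ma mnmwiden_ordmax.
Qed.

(* The family indexed by the variables of K[[z, t]] with value G i at z_i and T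
   at t: zsubst F G is fps_comp F (zt_family G tvar). *)
Definition zt_family p (G : 'I_n -> fps K p) (T : fps K p) : 'I_n.+1 -> fps K p :=
  fun i => if unlift ord_max i is Some j then G j else T.

Lemma zt_familyz p (G : 'I_n -> fps K p) (T : fps K p) i : zt_family G T (zidx i) = G i.
Proof. by rewrite /zt_family zidxE liftK. Qed.

Lemma zt_familyt p (G : 'I_n -> fps K p) (T : fps K p) : zt_family G T ord_max = T.
Proof. by rewrite /zt_family unlift_none. Qed.

Lemma zt_family0 p (G : 'I_n -> fps K p) (T : fps K p) : (forall i, G i 0%MM = 0) -> T 0%MM = 0 ->
  forall i, zt_family G T i 0%MM = 0.
Proof. by move=> G0 T0 i; rewrite /zt_family; case: unlift. Qed.

Lemma tvar0 : tvar K n 0%MM = 0.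
Proof. by rewrite /= eq_sym mnm1_eq0. Qed.

Lemma zvar0 (i : 'I_n) : zvar K i 0%MM = 0.
Proof. by rewrite /= eq_sym mnm1_eq0. Qed.

(** Turns the inversion identity, stated in K[[z, t]], into a substitution into a series in z
    alone. *)
Lemma zsubst_widen f G : (forall i, G i 0%MM = 0) ->
  zsubst (fps_widen f) G = fps_comp f G.
Proof.
move=> G0; have GT0 := zt_family0 G0 tvar0.
rewrite /zsubst -[X in fps_comp _ X]/(zt_family G (tvar K n)).
have wL : linear (@fps_widen K n).
  by move=> c u v; apply/fpsP => m /=; case: ifP => _ //; rewrite mulr0 addr0.
move: f; apply: fps_linear_ext.
- by move=> c u v; rewrite wL fps_comp_is_linear.
- exact: fps_comp_is_linear.
- move=> d; exists d => f /fps_order_geP fd; apply: fps_comp_order_ge => //.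
  apply/fps_order_geP => m md /=; case: ifP => // _.
  exact: fd (leq_ltn_trans (mdeg_mnmz m) md).
- exact: fps_comp_continuous.
move=> a; rewrite fps_widen_mono !fps_comp_mono // big_ord_recr /=.
rewrite mnmwiden_ordmax expr0 mulr1; apply: eq_bigr => i _.
by rewrite mnmwiden_widen -[widen_ord _ i]/(zidx i) zt_familyz.
Qed.

(** Setting t = 0 is a substitution, and so inherits multiplicativity from [fps_compM]. *)
Lemma fps_at_t0E F : fps_at_t0 F = fps_comp F (zt_family (fps_var K (n:=n)) 0).
Proof.
have G0 : forall i, zt_family (fps_var K (n:=n)) 0 i 0%MM = 0.
  by apply: zt_family0 => // i; rewrite /= eq_sym mnm1_eq0.
move: F; apply: fps_linear_ext.
- by move=> c u v; apply/fpsP.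
- exact: fps_comp_is_linear.
- move=> d; exists d => f /fps_order_geP fd.
  by apply/fps_order_geP => m md /=; rewrite fd ?mdeg_mnmwiden.
- exact: fps_comp_continuous.
move=> a; rewrite fps_comp_mono // big_ord_recr /= zt_familyt.
under eq_bigr => i _ do rewrite -[widen_ord _ i]/(zidx i) zt_familyz.
have [a0|aN0] := eqVneq (a ord_max) 0%N; last first.
  rewrite expr0n (negbTE aN0) mulr0; apply/fpsP => m /=.
  case: eqP => // ma; case/eqP: aN0; rewrite -ma mnmwiden_ordmax //.
rewrite expr0n a0 mulr1 -[RHS](_ : fps_mono K (mnmz a) = _); last first.
  by rewrite fps_monoE; apply: eq_bigr => i _; rewrite mnmE.
apply/fpsP => m /=; congr (nat_of_bool _)%:R.
by apply/eqP/eqP => [<-|->]; rewrite ?mnmzK ?mnmwidenK.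
Qed.

Lemma fps_at_t0_monoid_morphism : monoid_morphism (@fps_at_t0 K n).
Proof.
have G0 : forall i, zt_family (fps_var K (n:=n)) 0 i 0%MM = 0.
  by apply: zt_family0 => // i; rewrite /= eq_sym mnm1_eq0.
split=> [|f g]; rewrite !fps_at_t0E; first exact: fps_comp1.
exact: fps_compM.
Qed.

End Time.

(** * Differential equations satisfied by the inversion pair *)

Section InversionPair.
Variables (K : numFieldType) (n : nat) (P : fps K n) (Q : fps K n.+1).
Hypothesis pair_PQ : deformed_inversion_pair P Q.

Local Notation t := (tvar K n).
Local Notation zd i := (fps_deriv (@zidx n i)).
Let G (i : 'I_n) : fps K n.+1 := zvar K i + t * zd i Q.
Let J : 'M[fps K n.+1]_n := \matrix_(i, j) zd i (zd j Q).
Let A : 'M[fps K n.+1]_n := map_mx (fun f => fps_comp f G) (fps_hessian P).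

Lemma tvar_neq0 : t != 0.
Proof.
apply/eqP => /fpsP /(_ U_(ord_max)%MM) /eqP.
by rewrite /= eqxx oner_eq0.
Qed.

Let G0 i : G i 0%MM = 0.
Proof.
rewrite fpsD zvar0 add0r.
have := @fps_order_geMr _ _ _ _ (zd i Q) (fps_order_ge1 (tvar0 K n)).
by move/fps_order_geP => ->; rewrite ?mdeg0.
Qed.

(** Substituting [G] into the i-th component of z - t grad P gives back z_i; what remains after
    cancelling z_i is t times the claim. *)
Lemma inversion_pair_zgrad i : zd i Q = fps_comp (fps_deriv i P) G.
Proof.
have [_ [/(_ i) + _]] := pair_PQ; rewrite -/G -(zsubst_widen _ G0) /zsubst.
rewrite -[X in fps_comp _ X]/(zt_family G t) => FG.
have GT0 := zt_family0 G0 (tvar0 K n).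
apply: (mulfI tvar_neq0); move: FG.
rewrite fps_compB fps_compM // !fps_comp_var // zt_familyz zt_familyt.
by rewrite /G => /eqP; rewrite subr_eq => /eqP /addrI.
Qed.

Lemma zd_tvar i : zd i t = 0.
Proof. by rewrite fps_deriv_var zidx_neq_max. Qed.

Lemma zd_zvar i j : zd i (zvar K j) = (i == j)%:R.
Proof. by rewrite fps_deriv_var !zidxE (inj_eq lift_inj). Qed.

Lemma zd_G i j : zd i (G j) = (1 + t *: J) i j.
Proof.
rewrite raddfD /= fps_derivM zd_tvar mul0r add0r zd_zvar.
by rewrite !mxE.
Qed.

Lemma fps_comp_hessian i j : A i j = fps_comp (fps_deriv i (fps_deriv j P)) G.
Proof. by rewrite !mxE. Qed.

(** Chain rule applied to [inversion_pair_zgrad]; by [zd_G] the Jacobian of [G] is [1 + t *: J]. *)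
Lemma zhessian_eq : J = (1 + t *: J) * A.
Proof.
apply/matrixP => i j; rewrite [LHS]mxE inversion_pair_zgrad fps_comp_chain //.
rewrite [RHS]mxE; apply: eq_bigr => k _.
by rewrite zd_G fps_comp_hessian mulrC.
Qed.

Lemma zhessian_inv : (1 + t *: J) * (1 - t *: A) = 1.
Proof.
have MA : (1 + t *: J) * (t *: A) = t *: J.
  by rewrite [in RHS]zhessian_eq; apply/esym/scalemxAr.
by rewrite mulrBr mulr1 MA addrK.
Qed.

Lemma zhessian_invl : (1 - t *: A) * (1 + t *: J) = 1.
Proof. exact: mulmx1C zhessian_inv. Qed.

(* 1 + t J is the inverse of 1 - t A, which commutes with A. *)
Lemma zhessian_comm : GRing.comm (1 + t *: J) A.
Proof.
set M := 1 + _; set N := 1 - t *: A.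
have NA : A * N = N * A.
  rewrite mulrBl mulrBr mul1r mulr1.
  by rewrite [A * _](esym (scalemxAr _ _ _)) [_ * A](esym (scalemxAl _ _ _)).
rewrite /GRing.comm -[LHS]mulr1 -zhessian_invl -/M -/N.
by rewrite mulrA -(mulrA M A N) NA !mulrA zhessian_inv mul1r.
Qed.

Lemma zhessian_nilpotent : hessian_nilpotent P -> exists k, J ^+ k = 0.
Proof.
case=> k Hk; exists k; rewrite zhessian_eq exprMn_comm; last exact: zhessian_comm.
(* Substitution of [G] is a ring morphism, so [A] inherits the nilpotency of the Hessian of [P];
   then [J ^+ k] is [(1 + t *: J) ^+ k * A ^+ k]. *)
pose phi : {rmorphism fps K n -> fps K n.+1} := HB.pack (fun f => fps_comp f G)
  (GRing.isZmodMorphism.Build _ _ (fun f => fps_comp f G) (fps_compB G))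
  (GRing.isMonoidMorphism.Build _ _ (fun f => fps_comp f G) (conj (fps_comp1 G0) (fps_compM G0))).
have -> : A = map_mx phi (fps_hessian P) by [].
by rewrite -map_mx_exp Hk map_mx0 mulr0.
Qed.

Lemma zlaplacian_inversion_pair : hessian_nilpotent P -> zlaplacian Q = 0.
Proof.
case/zhessian_nilpotent => k /mxtrace_nilpotent <-.
by apply: eq_bigr => i _; rewrite mxE.
Qed.

(** With [q] the gradient and [v] its t-derivative, differentiating [inversion_pair_zgrad] in t
    gives a linear equation for [v], solved by the known inverse of [1 - t *: A]. *)
Lemma zgrad_time_deriv i :
  fps_deriv ord_max (zd i Q) = \sum_(k < n) zd k Q * zd k (zd i Q).
Proof.
pose q : 'rV[fps K n.+1]_n := \row_k zd k Q.
pose v : 'rV[fps K n.+1]_n := \row_k fps_deriv ord_max (zd k Q).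
have vE : v = (q + t *: v) *m A.
  apply/rowP => j; rewrite [LHS]mxE inversion_pair_zgrad fps_comp_chain //.
  rewrite [RHS]mxE; apply: eq_bigr => k _; rewrite fps_comp_hessian mulrC.
  congr (_ * _); rewrite raddfD /= fps_derivM !fps_deriv_var eq_sym zidx_neq_max eqxx.
  by rewrite add0r mul1r !mxE.
have vJ : v = q *m J.
  have : v *m (1 - t *: A) = q *m A.
    by rewrite mulmxBr mulmx1 {1}vE mulmxDl -scalemxAr -scalemxAl addrK.
  move/(congr1 (mulmx^~ (1 + t *: J))); rewrite /= -!mulmxA.
  have -> : (1 - t *: A) *m (1 + t *: J) = 1%:M := zhessian_invl.
  rewrite mulmx1 => ->.
  (* What is left is [A * (1 + t *: J) = J], which is [zhessian_eq] with the factors exchanged. *)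
  by congr (_ *m _); rewrite [RHS]zhessian_eq; apply/esym/zhessian_comm.
have := congr1 (fun w : 'rV_n => w 0 i) vJ; rewrite !mxE => ->.
by apply: eq_bigr => k _; rewrite !mxE.
Qed.

(** A term free of z in [zd i Q] would come from a term of [Q] of degree 1 in z. *)
Lemma zgrad_vanish i (m : 'X_{1..n.+1}) : (forall j, m (@zidx n j) = 0%N) -> zd i Q m = 0.
Proof.
move=> m0; apply/eqP; rewrite /= mulf_eq0; apply/orP; right.
have [Qz _] := pair_PQ; apply: contraT => /Qz.
rewrite (bigD1 i) //= mnmDE m0 mnm1E eqxx big1 // => j /negbTE ji.
by rewrite mnmDE m0 mnm1E !zidxE (inj_eq lift_inj) eq_sym ji.
Qed.

(** The vanishing gradient excludes every monomial containing some z_i; the second hypothesis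
    excludes the pure powers of t. *)
Lemma zgrad_inj (F : fps K n.+1) : (forall i, zd i F = 0) ->
  (forall m : 'X_{1..n.+1}, (forall i, m (@zidx n i) = 0%N) -> F m = 0) -> F = 0.
Proof.
move=> dF F0; apply/fpsP => m; rewrite fps0.
have [/forallP m0|] := boolP [forall i : 'I_n, m (zidx i) == 0%N].
  by apply: F0 => i; apply/eqP.
by case/forallPn => i; apply: fps_deriv_eq0.
Qed.

Lemma hamilton_jacobi :
  2%:R *: fps_deriv ord_max Q = \sum_(k < n) zd k Q ^+ 2.
Proof.
apply/eqP; rewrite -subr_eq0; apply/eqP; apply: zgrad_inj => [i|m m0].
  (* Equality of the z-gradients: [zgrad_time_deriv] on one side, the derivative of the squares on
     the other, matched by symmetry of second derivatives. *)
  rewrite raddfB /= linearZ raddf_sum /= fps_deriv_comm zgrad_time_deriv scaler_sumr.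
  rewrite -sumrB big1 // => k _.
  by rewrite fps_derivX expr1 (fps_deriv_comm (zidx k)) subrr.
(* At a monomial free of z: both factors of any splitting of it are free of z as well, so the
   squares contribute 0 by [zgrad_vanish]; the t-derivative reads a coefficient of [Q] that is also
   free of z. *)
rewrite fpsD fpsN fps_sum fpsZ [X in _ * X](_ : _ = 0).
  rewrite mulr0 big1 ?subr0 // => k _; rewrite expr2 fpsM big1 // => ab /eqP mab.
  rewrite (@zgrad_vanish k ab.1) ?mul0r // => j.
  have := congr1 (fun k : 'X_{1..n.+1} => k (zidx j)) mab; rewrite m0 mnmDE => /esym/eqP.
  by rewrite addn_eq0 => /andP[/eqP].
apply/eqP; rewrite /= mulf_eq0; apply/orP; right.
have [Qz _] := pair_PQ; apply: contraT => /Qz.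
rewrite big1 // => j _.
by rewrite mnmDE m0 mnm1E eq_sym zidx_neq_max.
Qed.

Lemma inversion_pair_coef0 : Q 0%MM = 0.
Proof.
have [Qz _] := pair_PQ; apply/eqP; apply: contraT => /Qz.
by rewrite big1 // => j _; rewrite mnm0E.
Qed.

(** At t = 0 the family [G] becomes z, so [inversion_pair_zgrad] equates the gradients of
    [fps_at_t0 Q] and [P]; their constant terms are both 0. *)
Lemma inversion_pair_at_t0 : fps_order_ge 2 P -> fps_at_t0 Q = P.
Proof.
have [at1 atM] := fps_at_t0_monoid_morphism K n.
have zd_at i F : fps_at_t0 (zd i F) = fps_deriv i (fps_at_t0 F).
  apply/fpsP => m /=; rewrite mnmwiden_widen; congr (_ * F _).
  by rewrite mnmwidenD mnmwiden1.
have var0 (i : 'I_n) : fps_var K i 0%MM = 0 by rewrite /= eq_sym mnm1_eq0.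
have atG : (@fps_at_t0 K n) \o G = fps_var K (n:=n).
  apply: funext => i; rewrite /= [LHS](_ : _ = fps_at_t0 (zvar K i) + fps_at_t0 (t * zd i Q)) //.
  rewrite atM [fps_at_t0 t](_ : _ = 0) ?mul0r ?addr0.
    apply/fpsP => m /=; rewrite -mnmwiden1; congr (nat_of_bool _)%:R.
    by apply/eqP/eqP => [/(congr1 (@mnmz n))|->//]; rewrite !mnmzK.
  apply/fpsP => m /=; case: eqP => // /mnmP /(_ ord_max).
  by rewrite mnmwiden_ordmax mnm1E eqxx.
have dQP i : fps_deriv i (fps_at_t0 Q - P) = 0.
  rewrite raddfB /= -zd_at inversion_pair_zgrad fps_comp_map //.
  - by rewrite atG fps_comp_id subrr.
  - move=> d; exists d => f /fps_order_geP fd.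
    by apply/fps_order_geP => m md /=; rewrite fd ?mdeg_mnmwiden.
  - by move=> j; rewrite -[fps_at_t0 _]/(((@fps_at_t0 K n) \o G) j) atG.
move=> P2; apply/eqP; rewrite -subr_eq0; apply/eqP/fpsP => m; rewrite fps0.
have [->|] := eqVneq m 0%MM.
  rewrite fpsD fpsN /= mnmwiden0 inversion_pair_coef0.
  by move/fps_order_geP: P2 => ->; rewrite ?subrr ?mdeg0.
rewrite -mdeg_eq0 mdegE sum_nat_eq0 => /forall_inPn[i _ mi].
exact: fps_deriv_eq0 (dQP i) mi.
Qed.

End InversionPair.

(** * The heat equation: existence and uniqueness *)

Section Heat.
Variables (K : numFieldType) (n : nat).

Lemma fps_at_t0_exp (F : fps K n.+1) : fps_at_t0 (fps_exp F) = fps_exp (fps_at_t0 F).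
Proof.
have [at1 atM] := fps_at_t0_monoid_morphism K n.
apply/fpsP => m /=; rewrite mdeg_mnmwiden; apply: eq_bigr => k _; congr (_ * _).
rewrite -[LHS]/(fps_at_t0 (F ^+ k) m); congr (fps_coef _ m).
by elim: (k : nat) => [|j IH]; rewrite ?at1 // !exprS atM IH.
Qed.

Lemma heat_eq0 (c : K) (W : fps K n.+1) :
  fps_deriv ord_max W = c *: zlaplacian W -> fps_at_t0 W = 0 -> W = 0.
Proof.
move=> heat W0; apply/fpsP => m; rewrite fps0.
elim: (m ord_max) {-2}m (erefl (m ord_max)) => [|a IH] {}m ma.
  have := congr1 (fun h : fps K n => h (mnmz m)) W0.
  by rewrite fps0 /= mnmwidenK.
(* One power of t lower, the left side is a nonzero integer times [W m], while the Laplacian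
   involves only coefficients of t-exponent [a], zero by induction. *)
have um : (U_(ord_max) <= m)%MM by rewrite lep1mP ma.
have := congr1 (fun h : fps K n.+1 => h (m - U_(ord_max))%MM) heat.
rewrite /= submK // fps_sum big1 => [|i _].
  by rewrite mulr0 => /eqP; rewrite mulf_eq0 pnatr_eq0 /= => /eqP.
rewrite /= IH ?mulr0 // !mnmDE mnmBE ma !mnm1E eqxx zidx_neq_max.
by rewrite subn1 !addn0.
Qed.

Lemma heat_exp (s : K) (Q : fps K n.+1) : s != 0 -> Q 0%MM = 0 -> zlaplacian Q = 0 ->
  2%:R *: fps_deriv ord_max Q = \sum_(k < n) fps_deriv (zidx k) Q ^+ 2 ->
  fps_deriv ord_max (fps_exp (s *: Q)) = (1 / (2 * s)) *: zlaplacian (fps_exp (s *: Q)).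
Proof.
move=> s0 Q0 lapQ hj.
have sQ0 : (s *: Q) 0%MM = 0 by rewrite fpsZ Q0 mulr0.
set U := fps_exp _.
have dU i : fps_deriv i U = s *: (U * fps_deriv i Q).
  by rewrite fps_exp_deriv // linearZ -scalerAr.
have -> : zlaplacian U = (s ^+ 2 * 2%:R) *: (U * fps_deriv ord_max Q).
  (* The vanishing Laplacian term is put back so that both sides agree summand by summand under the
     Leibniz rule. *)
  have lap0 : s *: U * zlaplacian Q = 0 by rewrite lapQ mulr0.
  rewrite -scalerA scalerAr hj -[RHS]addr0 -[X in _ = _ + X]lap0.
  rewrite /zlaplacian !mulr_sumr scaler_sumr -big_split; apply: eq_bigr => i _ /=.
  rewrite dU linearZ /= fps_derivM dU scalerDr -!scalerAl scalerA -expr2.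
  by rewrite -mulrA -expr2.
rewrite dU scalerA; congr (_ *: _).
rewrite div1r expr2 -mulrA -(mulrC 2) mulrCA mulVf ?mulr1 //.
by rewrite mulf_neq0 // pnatr_eq0.
Qed.

Lemma heat_cauchy_inversion_pair (s : K) (P : fps K n) (Q : fps K n.+1) :
  hessian_nilpotent P -> fps_order_ge 2 P -> deformed_inversion_pair P Q -> s != 0 ->
  heat_cauchy_solution s P (fps_exp (s *: Q)).
Proof.
move=> nilP P2 PQ s0; split.
  apply: heat_exp => //; first exact: inversion_pair_coef0 PQ.
    exact: zlaplacian_inversion_pair PQ nilP.
  exact: hamilton_jacobi PQ.
by rewrite fps_at_t0_exp -(inversion_pair_at_t0 PQ P2).
Qed.

(** The difference of two solutions solves the same linear equation with initial value 0. *)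
Lemma heat_cauchy_uniq (s : K) (P : fps K n) (U V : fps K n.+1) :
  heat_cauchy_solution s P U -> heat_cauchy_solution s P V -> V = U.
Proof.
move=> [hU U0] [hV V0]; apply/eqP; rewrite -subr_eq0; apply/eqP.
apply: (@heat_eq0 (1 / (2 * s))).
  rewrite raddfB /= hU hV -scalerBr /zlaplacian -sumrB; congr (_ *: _).
  by apply: eq_bigr => i _; rewrite !raddfB.
by apply/fpsP => m; rewrite -[LHS]/(fps_at_t0 V m - fps_at_t0 U m) U0 V0 subrr.
Qed.

End Heat.

Theorem theorem3p2 (R : realType) (n : nat) (P : fps R[i] n) (Q : fps R[i] n.+1)
    (s : R[i]) :
  hessian_nilpotent P -> fps_order_ge 2 P ->
  deformed_inversion_pair P Q -> s != 0 ->
  heat_cauchy_solution s P (fps_exp (s *: Q)) /\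
  (forall V : fps R[i] n.+1,
     heat_cauchy_solution s P V -> V = fps_exp (s *: Q)).
Proof.
move=> nilP P2 PQ s0.
have sol := heat_cauchy_inversion_pair nilP P2 PQ s0.
by split=> // V; apply: heat_cauchy_uniq.
Qed.
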